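(* Let $\mathcal V$ be a quantale. Every lax extension of a functor $F\colon\mathsf{Set}\to\mathsf{Set}$ to $\mathcal V\text{-}\mathsf{Rel}$ is an initial extension with respect to the lax extensions $\widehat{D}_\kappa$ of the functors $D_\kappa\colon\mathsf{Set}\to\mathsf{Set}$ ($\kappa$ a cardinal). That is, for every lax extension $\widehat F$ of $F$ there is a class-indexed family $(\alpha_i\colon F\to D_{\kappa_i})_{i\in I}$ of natural transformations, with each $\kappa_i$ a cardinal, such that for every $\mathcal V$-relation $r\colon X\nrightarrow Y$, $$\widehat Fr=\bigwedge_{i\in I}(\alpha_{i})_Y^\circ\cdot\widehat D_{\kappa_i}r\cdot(\alpha_{i})_X .$$
   Context: A quantale $\mathcal V$ is a complete lattice with a commutative monoid structure $(\otimes,k)$ such that each $u\otimes-$ preserves suprema; $\hom(u,-)$ denotes the right adjoint of $u\otimes -$. A $\mathcal V$-relation $r\colon X\nrightarrow Y$ is a map $X\times Y\to\mathcal V$. For $r\colon X\nrightarrow Y$, $s\colon Y\nrightarrow Z$, the composite is $(s\cdot r)(x,z)=\bigvee_{y}r(x,y)\otimes s(y,z)$; $1_X$ has value $k$ on the diagonal and $\bot$ elsewhere; $\mathcal V\text{-}\mathsf{Rel}$ is the category of sets and $\mathcal V$-relations. $\mathcal V$-relations are ordered pointwise; $r^\circ(y,x)=r(x,y)$ is the converse. A function $f\colon X\to Y$ is regarded as the $\mathcal V$-relation with value $k$ on the graph of $f$ and $\bot$ elsewhere. A lax extension of $F$ to $\mathcal V\text{-}\mathsf{Rel}$ is an assignment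 $(r\colon X\nrightarrow Y)\mapsto(\widehat Fr\colon FX\nrightarrow FY)$ such that (L1) $r\le r'$ implies $\widehat Fr\le\widehat Fr'$; (L2) $\widehat Fs\cdot\widehat Fr\le\widehat F(s\cdot r)$; (L3) $Ff\le\widehat Ff$ and $(Ff)^\circ\le\widehat F(f^\circ)$ for all functions $f$. The generalized monotone neighbourhood functor $D_\kappa\colon\mathsf{Set}\to\mathsf{Set}$ sends a set $X$ to the set of all monotone maps $\Phi$ from the set of $\mathcal V$-relations $X\nrightarrow\kappa$ (ordered pointwise; equivalently the functions $X\to\mathcal V^\kappa$) to $\mathcal V$, and a function $f\colon X\to Y$ to $D_\kappa f\colon\Phi\mapsto(g\mapsto\Phi(g\cdot f))$, for $g\colon Y\nrightarrow\kappa$. Its canonical lax extension $\widehat D_\kappa$ is given, for $r\colon X\nrightarrow Y$, by $(\widehat D_\kappa r)(\Phi,\Psi)=\bigwedge_{g\colon Y\nrightarrow\kappa}\hom(\Psi(g),\Phi(g\cdot r))$. *)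

(* Defs.v *)
From HB Require Import structures.
From mathcomp Require Import all_boot all_order.
From mathcomp Require Import boolp classical_sets.

Set Implicit Arguments.
Unset Strict Implicit.
Unset Printing Implicit Defensive.

Import Order.TTheory.
Local Open Scope classical_set_scope.
Local Open Scope order_scope.

(* The objects of the category Set form one fixed universe; naming it forces
   source and target of every functor below to live in the same universe. *)
Definition SET := Type.

(* [I] lives in a larger universe than SET, which alone does not bound its
   size by that of a class: the collection of all natural transformations
   between two functors also lives there. A class is a collection of pairs
   [(X, a)] with [X] a set and [a] in a set [A X], up to bijection. *)
Definition is_class (I : Type) : Prop :=
  exists (A : SET -> SET) (e : I -> {X : SET & A X}),
    forall i j : I, e i = e j -> i = j.

HB.mixin Record isQuantale (d : Order.disp_t) V of Order.POrder d V := {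
  qsup : set V -> V;
  qsup_isLub : forall A : set V, isLub A (qsup A);
  qmul : V -> V -> V;
  qunit : V;
  qmulA : associative qmul;
  qmulC : commutative qmul;
  qmul1 : left_id qunit qmul;
  qmul_sup : forall (u : V) (A : set V), qmul u (qsup A) = qsup (qmul u @` A)
}.

#[short(type="quantaleType")]
HB.structure Definition Quantale (d : Order.disp_t) :=
  { V of isQuantale d V & Order.POrder d V }.

Arguments qunit {d s}.

#[local] Obligation Tactic := idtac.

Declare Scope quantale_scope.
Delimit Scope quantale_scope with Q.
Notation "u ⊗ v" := (qmul u v) (at level 40, left associativity)
  : quantale_scope.
Local Open Scope quantale_scope.

Section QuantaleOps.
Context {d : Order.disp_t} {V : quantaleType d}.

Definition qbot : V := qsup set0.

(* Joins and meets of families. The index type may be large: only the set of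
   values is ever formed. *)
Definition qjoin (J : Type) (f : J -> V) : V :=
  qsup [set v | exists j, v = f j].

Definition qmeet (J : Type) (f : J -> V) : V :=
  qsup (lbound [set v | exists j, v = f j]).

Definition qhom (u v : V) : V := qsup [set w | u ⊗ w <= v].

Lemma qjoin_ub (J : Type) (f : J -> V) j : f j <= qjoin f.
Proof.
by have [ub _] := qsup_isLub [set v | exists j, v = f j]; apply: ub; exists j.
Qed.

Lemma qjoin_le (J : Type) (f : J -> V) v : (forall j, f j <= v) -> qjoin f <= v.
Proof.
move=> fv; have [_] := qsup_isLub [set v | exists j, v = f j].
by apply=> _ [j ->].
Qed.

Lemma qmeet_lb (J : Type) (f : J -> V) j : qmeet f <= f j.
Proof.
have [_] := qsup_isLub (lbound [set v | exists j, v = f j]).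
by apply=> w; apply; exists j.
Qed.

Lemma qmeet_ge (J : Type) (f : J -> V) v : (forall j, v <= f j) -> v <= qmeet f.
Proof.
move=> vf; have [ub _] := qsup_isLub (lbound [set v | exists j, v = f j]).
by apply: ub => _ [j ->].
Qed.

Lemma qbot_le (v : V) : qbot <= v.
Proof. by have [_] := qsup_isLub (set0 : set V); apply=> w. Qed.

Lemma qmul_join (J : Type) (u : V) (f : J -> V) :
  u ⊗ qjoin f = qjoin (fun j => u ⊗ f j).
Proof.
rewrite qmul_sup; congr qsup; apply/seteqP; split=> v /=.
  by move=> [_ [j ->] <-]; exists j.
by move=> [j ->]; exists (f j) => //; exists j.
Qed.

Lemma qmul_joinl (J : Type) (u : V) (f : J -> V) :
  qjoin f ⊗ u = qjoin (fun j => f j ⊗ u).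
Proof.
by rewrite qmulC qmul_join; congr qjoin; apply/funext => j; exact: qmulC.
Qed.

Lemma qmul1r (u : V) : u ⊗ qunit = u. Proof. by rewrite qmulC qmul1. Qed.

Lemma qmul0 (u : V) : u ⊗ qbot = qbot.
Proof.
rewrite /qbot qmul_sup; congr qsup.
by apply/seteqP; split=> v //= [].
Qed.

Lemma qmul0l (u : V) : qbot ⊗ u = qbot. Proof. by rewrite qmulC qmul0. Qed.

Lemma qmul_le (u v w : V) : v <= w -> u ⊗ v <= u ⊗ w.
Proof.
move=> vw.
have -> : w = qjoin (fun b : bool => if b then v else w).
  apply/le_anti/andP; split.
    exact: (@qjoin_ub bool (fun b => if b then v else w) false).
  by apply: qjoin_le => -[].
rewrite qmul_join.
exact: (@qjoin_ub bool (fun b : bool => u ⊗ (if b then v else w)) true).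
Qed.

Lemma qmul_le2 (u u' v v' : V) : u <= u' -> v <= v' -> u ⊗ v <= u' ⊗ v'.
Proof.
move=> uu' vv'; apply: le_trans (qmul_le u vv') _.
by rewrite (qmulC u) (qmulC u'); exact: qmul_le.
Qed.

Lemma qhom_adj (u v w : V) : (u ⊗ w <= v) = (w <= qhom u v).
Proof.
have [ub lub] := qsup_isLub [set w | u ⊗ w <= v].
apply/idP/idP => [|wuv]; first exact: ub.
apply: le_trans (qmul_le u wuv) _.
rewrite /qhom qmul_sup.
have [_] := qsup_isLub (qmul u @` [set w | u ⊗ w <= v]).
by apply=> _ [z /= zv <-].
Qed.

End QuantaleOps.

Section VRel.
Context {d : Order.disp_t} (V : quantaleType d).

Definition vrel (X Y : SET) := X -> Y -> V.

Definition vle (X Y : SET) (r r' : vrel X Y) : Prop :=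
  forall x y, r x y <= r' x y.

Definition vcomp (X Y Z : SET) (s : vrel Y Z) (r : vrel X Y) : vrel X Z :=
  fun x z => qjoin (fun y : Y => r x y ⊗ s y z).

Definition vconv (X Y : SET) (r : vrel X Y) : vrel Y X := fun y x => r x y.

Definition vgraph (X Y : SET) (f : X -> Y) : vrel X Y :=
  fun x y => if `[< f x = y >] then qunit else qbot.

Definition vmeet (J : Type) (X Y : SET) (r : J -> vrel X Y) : vrel X Y :=
  fun x y => qmeet (fun j => r j x y).

Lemma vgraph_eq (X Y : SET) (f : X -> Y) x : vgraph f x (f x) = qunit.
Proof. by rewrite /vgraph; case: asboolP. Qed.

Lemma vgraph_le (X Y : SET) (f : X -> Y) (r : vrel X Y) :
  (forall x, qunit <= r x (f x)) -> vle (vgraph f) r.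
Proof.
move=> fr x y; rewrite /vgraph; case: asboolP => [<-//|_]; exact: qbot_le.
Qed.

Lemma vcomp_graph (X Y Z : SET) (s : vrel Y Z) (f : X -> Y) :
  vcomp s (vgraph f) = fun x z => s (f x) z.
Proof.
apply/funext => x; apply/funext => z; apply/le_anti/andP; split.
  apply: qjoin_le => y; rewrite /vgraph; case: asboolP => [->|_].
    by rewrite qmul1.
  by rewrite qmul0l qbot_le.
apply: le_trans (qjoin_ub _ (f x)).
by rewrite vgraph_eq qmul1.
Qed.

Lemma vcompA (X Y Z W : SET) (t : vrel Z W) (s : vrel Y Z) (r : vrel X Y) :
  vcomp t (vcomp s r) = vcomp (vcomp t s) r.
Proof.
apply/funext => x; apply/funext => w; apply/le_anti/andP; split.
  apply: qjoin_le => z; rewrite /vcomp qmul_joinl; apply: qjoin_le => y.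
  rewrite -qmulA; apply: le_trans (qjoin_ub _ y); apply: qmul_le.
  exact: (qjoin_ub (fun z => s y z ⊗ t z w)).
apply: qjoin_le => y; rewrite /vcomp qmul_join; apply: qjoin_le => z.
rewrite qmulA; apply: le_trans (qjoin_ub _ z); apply: qmul_le2 => //.
exact: (qjoin_ub (fun y => r x y ⊗ s y z)).
Qed.

Lemma vcomp_le (X Y Z : SET) (s s' : vrel Y Z) (r r' : vrel X Y) :
  vle s s' -> vle r r' -> vle (vcomp s r) (vcomp s' r').
Proof.
move=> ss' rr' x z; apply: qjoin_le => y.
by apply: le_trans (qjoin_ub _ y); apply: qmul_le2.
Qed.

End VRel.

Record set_functor := SetFunctor {
  fobj :> SET -> SET;
  fmap : forall X Y : SET, (X -> Y) -> fobj X -> fobj Y;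
  fmap_id : forall X : SET, fmap (@id X) =1 id;
  fmap_comp : forall (X Y Z : SET) (g : Y -> Z) (f : X -> Y),
    fmap (g \o f) =1 fmap g \o fmap f
}.

Arguments fmap F {X Y} f _ : rename.

Record nat_trans (F G : set_functor) := NatTrans {
  ncomp :> forall X : SET, F X -> G X;
  ncomp_nat : forall (X Y : SET) (f : X -> Y),
    @ncomp Y \o fmap F f =1 fmap G f \o @ncomp X
}.

Section LaxExtension.
Context {d : Order.disp_t} (V : quantaleType d).

Record lax_extension (F : set_functor) := LaxExtension {
  lax :> forall X Y : SET, vrel V X Y -> vrel V (F X) (F Y);
  lax_mono : forall (X Y : SET) (r r' : vrel V X Y),
    vle r r' -> vle (lax r) (lax r');
  lax_comp : forall (X Y Z : SET) (s : vrel V Y Z) (r : vrel V X Y),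
    vle (vcomp (lax s) (lax r)) (lax (vcomp s r));
  lax_graph : forall (X Y : SET) (f : X -> Y),
    vle (vgraph V (fmap F f)) (lax (vgraph V f)) /\
    vle (vconv (vgraph V (fmap F f))) (lax (vconv (vgraph V f)))
}.

Definition is_initial_extension (F : set_functor) (Fhat : lax_extension F)
    (I : Type) (G : I -> set_functor) (Ghat : forall i, lax_extension (G i))
    (alpha : forall i, nat_trans F (G i)) : Prop :=
  forall (X Y : SET) (r : vrel V X Y),
    Fhat X Y r =
    vmeet (fun i => vcomp (vconv (vgraph V (alpha i Y)))
                      (vcomp (Ghat i X Y r) (vgraph V (alpha i X)))).

End LaxExtension.

(* A cardinal is represented by any set [kappa] of that cardinality. *)
Section GeneralizedNeighbourhood.
Context {d : Order.disp_t} (V : quantaleType d) (kappa : SET).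

Record mono_fun (X : SET) : SET := MonoFun {
  mfun :> vrel V X kappa -> V;
  mfun_mono : forall g g' : vrel V X kappa, vle g g' -> mfun g <= mfun g'
}.

Lemma mono_funP (X : SET) (Phi Psi : mono_fun X) : Phi =1 Psi -> Phi = Psi.
Proof.
case: Phi Psi => [p pm] [q qm] /= /funext pq; case: _ / pq qm => qm.
by congr MonoFun; exact: Prop_irrelevance.
Qed.

Program Definition Dmap (X Y : SET) (f : X -> Y) (Phi : mono_fun X) :
    mono_fun Y :=
  @MonoFun Y (fun g => Phi (vcomp g (vgraph V f))) _.
Next Obligation.
by move=> X Y f Phi g g' gg'; apply: mfun_mono; exact: vcomp_le.
Qed.

Program Definition D : set_functor := @SetFunctor mono_fun Dmap _ _.
Next Obligation.
by move=> X Phi; apply: mono_funP => g /=; rewrite vcomp_graph.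
Qed.
Next Obligation.
by move=> X Y Z g f Phi; apply: mono_funP => h /=; rewrite !vcomp_graph.
Qed.

Definition Dlax_fun (X Y : SET) (r : vrel V X Y) : vrel V (D X) (D Y) :=
  fun Phi Psi =>
    qmeet (fun g : vrel V Y kappa => qhom (Psi g) (Phi (vcomp g r))).

Program Definition Dlax : lax_extension V D :=
  @LaxExtension _ V D Dlax_fun _ _ _.
Next Obligation.
move=> X Y r r' rr' Phi Psi; apply: qmeet_ge => g.
apply: le_trans (qmeet_lb _ g) _; rewrite -qhom_adj.
have : Psi g ⊗ qhom (Psi g) (Phi (vcomp g r)) <= Phi (vcomp g r).
  by rewrite qhom_adj.
by move/le_trans; apply; apply: mfun_mono; exact: vcomp_le.
Qed.
Next Obligation.
move=> X Y Z s r Phi Theta; apply: qjoin_le => Psi; apply: qmeet_ge => g.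
rewrite -qhom_adj (qmulC (Dlax_fun _ _ _)) qmulA.
apply: le_trans
  (_ : Psi (vcomp g s) ⊗ qhom (Psi (vcomp g s)) (Phi (vcomp (vcomp g s) r))
       <= _); last by rewrite qhom_adj vcompA.
apply: qmul_le2; last exact: (qmeet_lb _ (vcomp g s)).
rewrite qhom_adj; exact: (qmeet_lb _ g).
Qed.
Next Obligation.
move=> X Y f; split.
  apply: vgraph_le => Phi; apply: qmeet_ge => g.
  by rewrite -qhom_adj qmul1r.
move=> Psi Phi; have: vle (vgraph V (Dmap f)) (vconv (Dlax_fun (vconv (vgraph V f)))).
  apply: vgraph_le => {}Phi; apply: qmeet_ge => g /=.
  rewrite -qhom_adj qmul1r /=; apply: mfun_mono => x k.
  rewrite vcomp_graph; apply: le_trans (qjoin_ub _ x).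
  by rewrite /vconv vgraph_eq qmul1.
exact.
Qed.

End GeneralizedNeighbourhood.

(* Main.v *)
Require Import Defs.
From mathcomp Require Import all_boot all_order.
From mathcomp Require Import boolp classical_sets.

(** Every set [K] and every [b] in [F K] determine a natural transformation
    from [F] to [D V K], sending [t] in [F X] to the monotone map
    [g |-> Fhat g t b] on relations [g] from [X] to [K]
    ([lax_to_nbhd]). Naturality is the identity
    [Fhat (g . f) = Fhat g . F f] ([lax_vcomp_graph]), which every lax
    extension satisfies for functions [f]. The family of all these
    transformations is indexed by the pairs [(K, b)], hence by a class, and it
    is initial for the following reasons.

    Each component of the meet is an upper bound of [Fhat r t u]: by
    adjunction this says
    [Fhat r t u ⊗ Fhat g u b <= Fhat (g . r) t b], an instance of
    the lax functoriality of [Fhat]. Conversely, the meet is already below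
    [Fhat r t u] because of the single index [K = Y], [b = u], as in the
    Yoneda lemma: at [g = 1_Y] the component is at most
    [qhom (Fhat 1_Y u u) (Fhat r t u)], and the unit of [V] is below
    [Fhat 1_Y u u]. *)

Set Implicit Arguments.
Unset Strict Implicit.
Unset Printing Implicit Defensive.

Import Order.TTheory.
Local Open Scope order_scope.
Local Open Scope quantale_scope.

Section RelationsAndFunctions.
Context {d : Order.disp_t} (V : quantaleType d).

Lemma vcomp_conv_graph (X Y Z : SET) (f : Z -> Y) (r : vrel V X Y) :
  vcomp (vconv (vgraph V f)) r = fun x z => r x (f z).
Proof.
apply/funext => x; apply/funext => z; apply/le_anti/andP; split.
  apply: qjoin_le => y; rewrite /vconv /vgraph; case: asboolP => [<-|_].
    by rewrite qmul1r.
  by rewrite qmul0 qbot_le.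
apply: le_trans (qjoin_ub _ (f z)).
by rewrite /vconv vgraph_eq qmul1r.
Qed.

Lemma vcomp_id_graph (X Y : SET) (r : vrel V X Y) :
  vcomp (vgraph V (@id Y)) r = r.
Proof.
have -> : vgraph V (@id Y) = vconv (vgraph V id).
  by apply/funext => y; apply/funext => y'; congr (if _ then _ else _);
    apply: asbool_equiv_eq; split.
exact: vcomp_conv_graph.
Qed.

Lemma qhom_le_of_unit_le (u v : V) : qunit <= u -> qhom u v <= v.
Proof.
move=> ku; rewrite -[leLHS]qmul1.
by apply: (@le_trans _ _ (u ⊗ qhom u v)); [exact: qmul_le2 | rewrite qhom_adj].
Qed.

End RelationsAndFunctions.

Section LaxExtensionTheory.
Context {d : Order.disp_t} (V : quantaleType d).
Context (F : set_functor) (Fhat : lax_extension V F).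

Lemma lax_mul_le (X Y Z : SET) (r : vrel V X Y) (s : vrel V Y Z) t u w :
  Fhat X Y r t u ⊗ Fhat Y Z s u w <= Fhat X Z (vcomp s r) t w.
Proof.
exact: le_trans (qjoin_ub (fun u => Fhat X Y r t u ⊗ Fhat Y Z s u w) u)
  (lax_comp Fhat s r t w).
Qed.

Lemma lax_graph_ge (X Y : SET) (f : X -> Y) t :
  qunit <= Fhat X Y (vgraph V f) t (fmap F f t).
Proof.
by have [+ _] := lax_graph Fhat f => /(_ t (fmap F f t)); rewrite vgraph_eq.
Qed.

Lemma lax_conv_graph_ge (X Y : SET) (f : X -> Y) t :
  qunit <= Fhat Y X (vconv (vgraph V f)) (fmap F f t) t.
Proof.
have [_ /(_ (fmap F f t) t)] := lax_graph Fhat f.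
by rewrite {1}/vconv vgraph_eq.
Qed.

Lemma lax_id_ge (X : SET) (t : F X) : qunit <= Fhat X X (vgraph V id) t t.
Proof. by have := lax_graph_ge (@id X) t; rewrite fmap_id. Qed.

(** Although [Fhat] is only laxly functorial, it preserves precomposition with
    a function strictly: [F f] is below [Fhat f], which gives one inequality,
    and the converse of [F f] is below [Fhat] of the converse of [f], which
    gives the other because [f . f°] is below the identity. *)
Lemma lax_vcomp_graph (X Y Z : SET) (g : vrel V Y Z) (f : X -> Y) t w :
  Fhat X Z (vcomp g (vgraph V f)) t w = Fhat Y Z g (fmap F f t) w.
Proof.
apply/le_anti/andP; split; last first.
  rewrite -[leLHS]qmul1; apply: le_trans (lax_mul_le _ _ t (fmap F f t) w).
  exact: qmul_le2 (lax_graph_ge f t) (lexx _).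
have gff : vle (vcomp (vcomp g (vgraph V f)) (vconv (vgraph V f))) g.
  move=> y z; rewrite vcomp_graph; apply: qjoin_le => x.
  rewrite /vconv /vgraph; case: asboolP => [->|_]; first by rewrite qmul1.
  by rewrite qmul0l qbot_le.
apply: le_trans (lax_mono Fhat gff (fmap F f t) w).
rewrite -[leLHS]qmul1; apply: le_trans (lax_mul_le _ _ _ t w).
exact: qmul_le2 (lax_conv_graph_ge f t) (lexx _).
Qed.

Definition lax_nbhd (K : SET) (b : F K) (X : SET) (t : F X) : D V K X :=
  @MonoFun _ V K X (fun g => Fhat X K g t b)
    (fun g g' gg' => lax_mono Fhat gg' t b).

Lemma lax_nbhd_natural (K : SET) (b : F K) (X Y : SET) (f : X -> Y) :
  @lax_nbhd K b Y \o fmap F f =1 fmap (D V K) f \o @lax_nbhd K b X.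
Proof. by move=> t; apply: mono_funP => g /=; rewrite lax_vcomp_graph. Qed.

Definition lax_to_nbhd (K : SET) (b : F K) : nat_trans F (D V K) :=
  NatTrans (@lax_nbhd_natural K b).

Lemma lax_le_Dlax (K : SET) (b : F K) (X Y : SET) (r : vrel V X Y) t u :
  Fhat X Y r t u <=
  Dlax V K X Y r (lax_to_nbhd b X t) (lax_to_nbhd b Y u).
Proof. by apply: qmeet_ge => g; rewrite -qhom_adj qmulC; exact: lax_mul_le. Qed.

(** The Yoneda-style half of initiality: testing against [g = 1_Y] recovers
    [Fhat r] at the element [u] that defines the transformation. *)
Lemma Dlax_le_lax (X Y : SET) (r : vrel V X Y) t (u : F Y) :
  Dlax V Y X Y r (lax_to_nbhd u X t) (lax_to_nbhd u Y u) <= Fhat X Y r t u.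
Proof.
apply: le_trans (qmeet_lb _ (vgraph V id)) _ => /=.
by rewrite vcomp_id_graph; apply: qhom_le_of_unit_le; exact: lax_id_ge.
Qed.

End LaxExtensionTheory.

Theorem corollary4p19 (d : Order.disp_t) (V : quantaleType d)
    (F : set_functor) (Fhat : lax_extension V F) :
  exists (I : Type) (kappa : I -> SET)
    (alpha : forall i : I, nat_trans F (D V (kappa i))),
    is_class I /\
    is_initial_extension Fhat (fun i : I => Dlax V (kappa i)) alpha.
Proof.
exists {K : SET & F K}, (@projT1 _ _).
exists (fun i => lax_to_nbhd Fhat (projT2 i)).
split; first by exists F, id.
move=> X Y r; apply/funext => t; apply/funext => u; apply/le_anti/andP; split.
  by apply: qmeet_ge => i; rewrite vcomp_conv_graph vcomp_graph;
    exact: lax_le_Dlax.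
apply: le_trans (qmeet_lb _ (existT _ Y u)) _.
by rewrite vcomp_conv_graph vcomp_graph; exact: Dlax_le_lax.
Qed.
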